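(* Two computable probability measures on a constructive metric space are orthogonal if and only if they are effectively orthogonal.
   Context: A constructive metric space $(X,d,D,\alpha)$ is a complete separable metric space $(X,d)$ with a countable dense set $D$ and a numbering $\alpha:\mathbb{N}\to D$ such that $d(\alpha(m),\alpha(n))$ is computable uniformly in $m,n$. Basic balls are open balls with centres in $D$ and rational radii; effectively open sets are unions of enumerable families of basic balls. The probability measures $\mathcal{M}(X)$ form a constructive metric space with the Prokhorov distance and dense set the rational-valued measures with finite support in $D$ (naturally numbered); computable measures are computable points of this space (e.g. points for which the set of basic balls containing them is enumerable). A function $f:X\times\mathcal{M}(X)\to[0,\infty]$ is lower semicomputable if each $\{f>r\}$, $r$ rational, is a union of an enumerable family of products of basic balls, uniformly in $r$. A uniform test is such $f$ with $\int f(x,P)\,dP(x)\le1$ for all $P$; for a universal (maximal up to a constant factor) uniform test $\mathbf{t}$, $x$ is uniformly random w.r.t. $P$ if $\mathbf{t}(x,P)<\infty$. Measures $P,Q$ are orthogonal if $X$ splits into disjoint Borel sets $U,V$ with $P(V)=Q(U)=0$; they are effectively orthogonal if no point is uniformly random with respect to both. *)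

(* Defs.v *)
From HB Require Import structures.
From Stdlib Require Cantor.
From mathcomp Require Import all_boot all_order all_algebra.
From mathcomp Require Import all_classical all_reals all_analysis.

Set Implicit Arguments.
Unset Strict Implicit.
Unset Printing Implicit Defensive.

Import Order.TTheory GRing.Theory Num.Theory.
Import numFieldNormedType.Exports.

Local Open Scope classical_set_scope.
Local Open Scope ring_scope.

Definition npair (m n : nat) : nat := Cantor.to_nat (m, n).
Definition nfst (n : nat) : nat := (Cantor.of_nat n).1.
Definition nsnd (n : nat) : nat := (Cantor.of_nat n).2.

(* Total recursive functions, with minimization restricted to regular
   functions (so that no partial function is needed); several arguments are
   passed as one through Cantor's pairing. *)
Inductive recursive : (nat -> nat) -> Prop :=
| recursive_zero : recursive (fun _ => 0%N)
| recursive_succ : recursive S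
| recursive_fst : recursive nfst
| recursive_snd : recursive nsnd
| recursive_pair f g :
    recursive f -> recursive g -> recursive (fun x => npair (f x) (g x))
| recursive_comp f g :
    recursive f -> recursive g -> recursive (fun x => f (g x))
| recursive_prim f g h :
    recursive f -> recursive g ->
    (forall x, h (npair x 0) = f x) ->
    (forall x n, h (npair x n.+1) = g (npair x (npair n (h (npair x n))))) ->
    recursive h
| recursive_mu f h :
    recursive f ->
    (forall x, f (npair x (h x)) = 0%N) ->
    (forall x n, (n < h x)%N -> f (npair x n) <> 0%N) ->
    recursive h.

Definition enumerable (A : set nat) : Prop :=
  A = set0 \/ exists2 f, recursive f & range f = A.

(* The numbering <<a, b>, c> |-> (a - b) / (c + 1) of the rationals. *)
Definition rat_num (n : nat) : rat :=
  ((nfst (nfst n))%:R - (nsnd (nfst n))%:R) / (nsnd n).+1%:R.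

(* The basic ball of number <i, q>; it is empty when the radius is not
   positive. *)
Definition basic_ball (R : realType) (T : Type) (dist : T -> T -> R)
    (center : nat -> T) (n : nat) : set T :=
  [set x | dist x (center (nfst n)) < ratr (rat_num (nsnd n))].

Definition computable_point (R : realType) (T : Type) (dist : T -> T -> R)
    (center : nat -> T) (x : T) : Prop :=
  enumerable [set n | basic_ball dist center n x].

#[short(type="completeMetricType")]
HB.structure Definition CompleteMetric (R : numDomainType) :=
  {T of Complete T & Metric R T}.

(* The countable dense set is D = range alpha. *)
Record constructive_metric_space (R : realType) (X : completeMetricType R)
    (alpha : nat -> X) : Prop := {
  alpha_dense : dense (range alpha) ;
  alpha_computable : exists2 f, recursive f &
    forall m n k,
      `| mdist (alpha m) (alpha n) -
         ratr (rat_num (f (npair (npair m n) k))) | <= 2^-1 ^+ k :> R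
}.

Notation borel X := (g_sigma_algebraType (@open X)).

Definition Prob (R : realType) (X : completeMetricType R) : Type :=
  probability (borel X) R.

Section measures.
Context (R : realType) (X : completeMetricType R).
Local Open Scope ereal_scope.

Definition thickening (A : set (borel X)) (e : R) : set (borel X) :=
  [set y | exists2 x, A x & (mdist (x : X) (y : X) < e)%R].

Definition prokhorov (P Q : Prob X) : R :=
  inf [set e : R | (0 < e)%R /\
    forall A : set (borel X), measurable A ->
      P A <= Q (thickening A e) + e%:E /\ Q A <= P (thickening A e) + e%:E].

(* The number <k, s> codes the list of the first k entries of the stream
   obtained by repeatedly unpairing s; an entry <a, w> is an atom alpha(a)
   with integer weight w.  Weights are normalized to total mass 1, so that
   exactly the finitely supported measures with rational weights arise; if
   all weights vanish the result is the Dirac mass at alpha(0). *)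
Definition atom_entry (s i : nat) : nat := nfst (iter i nsnd s).

Definition finite_measure_of_code (alpha : nat -> X) (n : nat) :=
  msum (fun i => mscale ((nsnd (atom_entry (nsnd n) i))%:R%:nng)%R
                   (@dirac _ (borel X) (alpha (nfst (atom_entry (nsnd n) i))) R))
       (nfst n).

Definition prob_num (alpha : nat -> X) (n : nat) : Prob X :=
  mnormalize (finite_measure_of_code alpha n)
             (@dirac _ (borel X) (alpha 0%N) R).

Definition computable_measure (alpha : nat -> X) (P : Prob X) : Prop :=
  computable_point prokhorov (prob_num alpha) P.

(* Uniformity in the rational threshold: one enumerable set of pairs
   <r, <i, j>> serves for all r. *)
Definition lower_semicomputable (alpha : nat -> X)
    (f : X -> Prob X -> \bar R) : Prop :=
  exists2 W : set nat, enumerable W &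
    forall r : nat,
      [set xP : X * Prob X | (ratr (rat_num r))%:E < f xP.1 xP.2] =
      \bigcup_(n in [set n | W (npair r n)])
        (basic_ball (@mdist R X) alpha (nfst n) `*`
         basic_ball prokhorov (prob_num alpha) (nsnd n)).

Record uniform_test (alpha : nat -> X) (f : X -> Prob X -> \bar R) : Prop := {
  uniform_test_ge0 : forall x P, 0 <= f x P ;
  uniform_test_lsc : lower_semicomputable alpha f ;
  uniform_test_int : forall P : Prob X,
    \int[P]_(x in [set: borel X]) f x P <= 1
}.

Definition universal_uniform_test (alpha : nat -> X)
    (t : X -> Prob X -> \bar R) : Prop :=
  uniform_test alpha t /\
  forall f, uniform_test alpha f ->
    exists2 c : R, (0 < c)%R & forall x P, f x P <= c%:E * t x P.

Definition uniformly_random (t : X -> Prob X -> \bar R) (x : X) (P : Prob X)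
  : Prop := t x P < +oo.

Definition orthogonal_measures (P Q : Prob X) : Prop :=
  exists U V : set (borel X),
    [/\ measurable U, measurable V, U `|` V = setT, U `&` V = set0 &
        P V = 0 /\ Q U = 0].

Definition effectively_orthogonal (t : X -> Prob X -> \bar R) (P Q : Prob X)
  : Prop := ~ exists x, uniformly_random t x P /\ uniformly_random t x Q.

End measures.

(* Main.v *)
Require Import Defs.
From mathcomp Require Import all_boot all_order all_algebra.
From mathcomp Require Import all_classical all_reals all_analysis.
From mathcomp Require Import measurable_realfun lra zify.

(* If [P] and [Q] are orthogonal then, for every [m], [X] is covered by two open
   sets [A_m] and [B_m], with [P (A_m)] and [Q (B_m)] at most [2^-(2m+1)].  Both
   are unions of balls of a common radius [2^-k] with centers in [D]: the center
   [c] is used for [A_m] or for [B_m] according to a decidable approximate test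
   of whether [c] is close to a suitable finite set [I] of points of [D].
   Finitely supported measures [mu], [nu] within [2^-k] of [P], [Q] certify the
   two bounds by a finite computation, simultaneously for all measures in the
   Prokhorov balls around [mu], [nu].  Since such data exist (outer regularity)
   and are recognizable, they can be found recursively in [m], and
     [f (x, P') = sup {m | x in A_m and P' in the m-th ball}]
   is a uniform test, likewise for [B_m].  Each [x] lies in infinitely many
   [A_m] or in infinitely many [B_m], so one of the two tests is infinite at
   [(x, P)], resp. [(x, Q)].
   Conversely the set [t (_, P) = oo] separates [P] from [Q] when they are
   effectively orthogonal. *)

Set Implicit Arguments.
Unset Strict Implicit.
Unset Printing Implicit Defensive.

Import Order.TTheory GRing.Theory Num.Theory.
Import numFieldNormedType.Exports.

Local Open Scope classical_set_scope.
Local Open Scope ring_scope.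

(** * Recursive functions *)

Lemma nfst_pair a b : nfst (npair a b) = a.
Proof. by rewrite /nfst /npair Cantor.cancel_of_to. Qed.

Lemma nsnd_pair a b : nsnd (npair a b) = b.
Proof. by rewrite /nsnd /npair Cantor.cancel_of_to. Qed.

Definition npairE := (nfst_pair, nsnd_pair).

Lemma npair_nfst_nsnd n : npair (nfst n) (nsnd n) = n.
Proof. by rewrite /npair -surjective_pairing Cantor.cancel_to_of. Qed.

Lemma eq_recursive (f g : nat -> nat) : f =1 g -> recursive f -> recursive g.
Proof. by move=> /funext ->. Qed.

Lemma recursive_id : recursive id.
Proof.
apply: eq_recursive (recursive_pair recursive_fst recursive_snd).
exact: npair_nfst_nsnd.
Qed.

Lemma recursive_const c : recursive (fun=> c).
Proof.
elim: c => [|c IH]; first exact: recursive_zero.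
exact: (recursive_comp recursive_succ IH).
Qed.

Lemma recursive_nfst f : recursive f -> recursive (fun x => nfst (f x)).
Proof. exact: recursive_comp recursive_fst. Qed.

Lemma recursive_nsnd f : recursive f -> recursive (fun x => nsnd (f x)).
Proof. exact: recursive_comp recursive_snd. Qed.

Lemma recursive_S f : recursive f -> recursive (fun x => (f x).+1).
Proof. exact: recursive_comp recursive_succ. Qed.

(* The step function receives the parameter [x], the counter [n] and the
   previous value as the code [<x, <n, v>>]. *)
Lemma recursive_nat_rect (f g h : nat -> nat) :
  recursive f -> recursive g -> recursive h ->
  recursive (fun x => nat_rect (fun=> nat) (f x)
    (fun n v => g (npair x (npair n v))) (h x)).
Proof.
move=> rf rg rh.
pose F y := nat_rect (fun=> nat) (f (nfst y))
    (fun n v => g (npair (nfst y) (npair n v))) (nsnd y).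
have rF : recursive F.
  by apply: (recursive_prim rf rg) => x *; rewrite /F !npairE.
apply: eq_recursive (recursive_comp rF (recursive_pair recursive_id rh)) => x.
by rewrite /F !npairE.
Qed.

Lemma recursive_iter (g f h : nat -> nat) :
  recursive g -> recursive f -> recursive h ->
  recursive (fun x => iter (h x) g (f x)).
Proof.
move=> rg rf rh; apply: eq_recursive (recursive_nat_rect rf
  (recursive_comp rg (recursive_nsnd (recursive_nsnd recursive_id))) rh) => x.
by elim: (h x) => //= n ->; rewrite !npairE.
Qed.

Lemma recursive_sum (F : nat -> nat -> nat) h :
  recursive (fun y => F (nfst y) (nsnd y)) -> recursive h ->
  recursive (fun x => \sum_(i < h x) F x i)%N.
Proof.
move=> rF rh.
have radd : recursive (fun y => iter (nfst y) S (nsnd y)).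
  by apply: (recursive_iter recursive_succ); do ?constructor.
pose G y := F (nfst y) (nfst (nsnd y)).
have rG : recursive G.
  have := recursive_comp rF (recursive_pair recursive_fst
    (recursive_nfst recursive_snd)).
  by apply: eq_recursive => y; rewrite !npairE.
have rG' := recursive_comp radd (recursive_pair rG
  (recursive_nsnd recursive_snd)).
apply: eq_recursive (recursive_nat_rect recursive_zero rG' rh) => x.
elim: (h x) => [|n IH] /=; first by rewrite big_ord0.
rewrite big_ord_recr/= -IH /G !npairE addnC.
by elim: (F x n) => //= k ->.
Qed.

Lemma recursive_mul f g : recursive f -> recursive g ->
  recursive (fun x => f x * g x)%N.
Proof.
move=> rf rg; have := @recursive_sum (fun x=> fun=> g x) f
  (recursive_comp rg recursive_fst) rf.
by apply: eq_recursive => x; rewrite sum_nat_const card_ord.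
Qed.

Lemma recursive_add f g : recursive f -> recursive g ->
  recursive (fun x => f x + g x)%N.
Proof.
move=> rf rg; apply: eq_recursive (recursive_iter recursive_succ rg rf) => x.
by elim: (f x) => //= n ->.
Qed.

Lemma recursive_sub f g : recursive f -> recursive g ->
  recursive (fun x => f x - g x)%N.
Proof.
move=> rf rg.
have rp : recursive predn.
  apply: eq_recursive (recursive_nat_rect recursive_zero
    (recursive_nfst recursive_snd) recursive_id) => -[|x] //=.
  by rewrite !npairE.
apply: eq_recursive (recursive_iter rp rf rg) => x.
by elim: (g x) => [|n] /=; [rewrite subn0|move=> ->; rewrite subnS].
Qed.

Lemma recursive_exp2 f : recursive f -> recursive (fun x => 2 ^ f x)%N.
Proof.
move=> rf; have rd := recursive_add recursive_id recursive_id.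
apply: eq_recursive (recursive_iter rd (recursive_const 1) rf) => x.
by elim: (f x) => //= n ->; rewrite expnS mul2n addnn.
Qed.

Lemma recursive_leq f g : recursive f -> recursive g ->
  recursive (fun x => f x <= g x)%N.
Proof.
move=> rf rg; have := recursive_sub (recursive_const 1) (recursive_sub rf rg).
by apply: eq_recursive => x; rewrite -subn_eq0; case: (f x - g x)%N.
Qed.

Lemma recursive_andb (f g : nat -> bool) :
  recursive f -> recursive g -> recursive (fun x => f x && g x).
Proof.
move=> rf rg; apply: eq_recursive (recursive_mul rf rg) => x.
by rewrite mulnb.
Qed.

Lemma recursive_negb (f : nat -> bool) :
  recursive f -> recursive (fun x => ~~ f x).
Proof.
move=> rf; apply: eq_recursive (recursive_sub (recursive_const 1) rf) => x.
by case: (f x).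
Qed.

Lemma recursive_orb (f g : nat -> bool) :
  recursive f -> recursive g -> recursive (fun x => f x || g x).
Proof.
move=> rf rg; have := recursive_negb
  (recursive_andb (recursive_negb rf) (recursive_negb rg)).
by apply: eq_recursive => x; rewrite negb_and !negbK.
Qed.

Lemma recursive_eqn f g : recursive f -> recursive g ->
  recursive (fun x => f x == g x)%N.
Proof.
move=> rf rg; have := recursive_andb (recursive_leq rf rg)
  (recursive_leq rg rf).
by apply: eq_recursive => x; rewrite eqn_leq.
Qed.

Lemma recursive_has (p : nat -> nat -> bool) h :
  recursive (fun y => p (nfst y) (nsnd y)) -> recursive h ->
  recursive (fun x => has (p x) (iota 0 (h x))).
Proof.
move=> rp rh; have := recursive_leq (recursive_const 1)
  (@recursive_sum (fun x i => p x i) _ rp rh).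
apply: eq_recursive => x; rewrite has_count -sum1_count [in RHS]big_mkcond.
rewrite -(big_mkord xpredT (fun i => p x i : nat)) /index_iota subn0 /=.
by congr (nat_of_bool (0 < _)%N); apply: eq_bigr => i _; case: (p x i).
Qed.

Lemma recursive_if (b : nat -> bool) f g :
  recursive b -> recursive f -> recursive g ->
  recursive (fun x => if b x then f x else g x).
Proof.
move=> rb rf rg; have := recursive_add (recursive_mul rb rf)
  (recursive_mul (recursive_negb rb) rg).
by apply: eq_recursive => x; case: (b x) => /=; rewrite ?mul1n ?mul0n ?addn0.
Qed.

(** The enumeration runs through all pairs [<n, z>]; a pair that fails [p] is sent to the known
    member [w], which keeps the function total. *)
Lemma enumerable_ex (p : nat -> nat -> bool) w :
  recursive (fun y => p (nfst y) (nsnd y)) -> (exists z, p w z) ->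
  enumerable [set n | exists z, p n z].
Proof.
move=> rp pw; right.
exists (fun y => if p (nfst y) (nsnd y) then nfst y else w).
  by apply: recursive_if => //; [exact: recursive_fst|exact: recursive_const].
apply/seteqP; split => n /=.
  by move=> [y _ <-]; case: ifP => // py; exists (nsnd y).
by move=> [z pz]; exists (npair n z); rewrite ?npairE ?pz.
Qed.

(** The least witness is found by minimization, which is regular because a witness always exists. *)
Lemma recursive_selection (p : nat -> nat -> bool) :
  recursive (fun y => p (nfst y) (nsnd y)) -> (forall n, exists z, p n z) ->
  exists2 h, recursive h & forall n, p n (h n).
Proof.
move=> rp pex; exists (fun n => ex_minn (pex n)) => [|n];
  last by case: ex_minnP.
apply: (recursive_mu (recursive_negb rp)) => [x|x n]; rewrite !npairE.
  by case: ex_minnP => z ->.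
by case: ex_minnP => z _ zmin nz; case: (boolP (p x n)) => // /zmin; lia.
Qed.

(** A number of [2^-k] under [rat_num], where the stored denominator is one less than the actual
    one. *)
Definition radius_code (k : nat) : nat := npair (npair 1 0) (2 ^ k).-1.

Lemma recursive_radius_code h :
  recursive h -> recursive (fun x => radius_code (h x)).
Proof.
move=> rh; have := recursive_pair (recursive_const (npair 1 0))
  (recursive_sub (recursive_exp2 rh) (recursive_const 1)).
by apply: eq_recursive => x; rewrite subn1.
Qed.

Lemma recursive_atom_entry f g : recursive f -> recursive g ->
  recursive (fun x => atom_entry (f x) (g x)).
Proof.
by move=> rf rg; apply: recursive_nfst; apply: recursive_iter recursive_snd _ _.
Qed.

(** * Decidable tests on codes of distances and of finitely supported measures *)

Section codes.
Local Open Scope nat_scope.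
(* [delta <<i, j>, k>] is a number of a rational within [2^-k] of the distance
   from [alpha i] to [alpha j]. *)
Variable delta : nat -> nat.

(** Asks whether the [delta]-approximation, at precision [2^-k], of the distance from [alpha a] to
    some center listed in [I] is below [L * 2^-k]; denominators are cleared. *)
Definition near_center (L k I a : nat) : bool :=
  has (fun j => let d := delta (npair (npair a (atom_entry (nsnd I) j)) k) in
         nfst (nfst d) * 2 ^ k < nsnd (nfst d) * 2 ^ k + L * (nsnd d).+1)
      (iota 0 (nfst I)).

Definition weight (n i : nat) : nat := nsnd (atom_entry (nsnd n) i).
Definition atom (n i : nat) : nat := nfst (atom_entry (nsnd n) i).

Definition total_weight (n : nat) : nat := \sum_(i < nfst n) weight n i.

(** Atoms are selected by index rather than by point, so the sum is recursive when [p] is; divided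
    by a positive [total_weight n] it is a mass. *)
Definition weight_in (p : pred nat) (n : nat) : nat :=
  \sum_(i < nfst n) weight n i * p (atom n i).

Hypothesis rdelta : recursive delta.

Lemma recursive_near_center L k I a :
  recursive k -> recursive I -> recursive a ->
  recursive (fun x => near_center L (k x) (I x) (a x)).
Proof.
move=> rk rI ra.
have rk' := recursive_comp rk recursive_fst.
have ra' := recursive_comp ra recursive_fst.
have rI' := recursive_nsnd (recursive_comp rI recursive_fst).
have rd := recursive_comp rdelta (recursive_pair (recursive_pair ra'
  (recursive_atom_entry rI' recursive_snd)) rk').
apply: (@recursive_has (fun x j =>
  let d := delta (npair (npair (a x) (atom_entry (nsnd (I x)) j)) (k x)) in
  nfst (nfst d) * 2 ^ (k x) < nsnd (nfst d) * 2 ^ (k x) + L * (nsnd d).+1)).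
  apply: recursive_leq.
    apply: recursive_S; apply: recursive_mul (recursive_exp2 rk').
    exact: recursive_nfst (recursive_nfst rd).
  apply: recursive_add.
    apply: recursive_mul (recursive_exp2 rk').
    exact: recursive_nsnd (recursive_nfst rd).
  apply: recursive_mul (recursive_const L) _.
  exact: recursive_S (recursive_nsnd rd).
exact: recursive_nfst.
Qed.

Lemma recursive_weight n i : recursive n -> recursive i ->
  recursive (fun x => weight (n x) (i x)).
Proof.
move=> rn ri; apply: recursive_nsnd; apply: recursive_atom_entry => //.
exact: recursive_nsnd.
Qed.

Lemma recursive_total_weight n : recursive n ->
  recursive (fun x => total_weight (n x)).
Proof.
move=> rn; apply: (@recursive_sum (fun x i => weight (n x) i)).
  exact: recursive_weight (recursive_comp rn recursive_fst) recursive_snd.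
exact: recursive_nfst.
Qed.

Lemma recursive_weight_in (p : nat -> pred nat) n :
  recursive (fun y => p (nfst y) (nsnd y)) -> recursive n ->
  recursive (fun x => weight_in (p x) (n x)).
Proof.
move=> rp rn.
apply: (@recursive_sum (fun x i => weight (n x) i * p x (atom (n x) i)));
  last exact: recursive_nfst.
have rn' := recursive_comp rn recursive_fst.
have ra : recursive (fun y => atom (n (nfst y)) (nsnd y)).
  apply: recursive_nfst; apply: recursive_atom_entry recursive_snd.
  exact: recursive_nsnd.
apply: recursive_mul; first exact: recursive_weight rn' recursive_snd.
apply: eq_recursive (recursive_comp rp (recursive_pair recursive_fst ra)) => y.
by rewrite !npairE.
Qed.

End codes.

(** * Regularity of Borel measures *)

Lemma rat_num_surj (q : rat) : exists n, rat_num n = q.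
Proof.
have [d dE] : exists d, denq q = d.+1%:Z.
  by case: (denq q) (denq_gt0 q) => // -[|d] //; exists d.
have qE : q = (numq q)%:~R / d.+1%:R by rewrite -{1}[q]divq_num_den dE.
case: (numq q) qE => a qE.
  exists (npair (npair a 0) d); rewrite /rat_num !npairE subr0 qE.
  by rewrite -pmulrn.
exists (npair (npair 0 a.+1) d); rewrite /rat_num !npairE sub0r qE.
by rewrite NegzE mulrNz -pmulrn.
Qed.

Lemma ratr_rat_num (R : realType) (n : nat) :
  ratr (rat_num n) =
  ((nfst (nfst n))%:R - (nsnd (nfst n))%:R) / (nsnd n).+1%:R :> R.
Proof. by rewrite /rat_num rmorphM fmorphV rmorphB !rmorph_nat. Qed.

Lemma rat_num_ltE (R : realType) (n L k : nat) :
  (ratr (rat_num n) < L%:R * 2^-1 ^+ k :> R) =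
  (nfst (nfst n) * 2 ^ k < nsnd (nfst n) * 2 ^ k + L * (nsnd n).+1)%N.
Proof.
rewrite ratr_rat_num exprVn ltr_pdivrMr ?ltr0n// mulrAC.
rewrite ltr_pdivlMr ?exprn_gt0//.
by rewrite mulrBl ltrBlDl -(ltr_nat R) natrD !natrM natrX.
Qed.

Lemma ratr_radius_code (R : realType) (k : nat) :
  ratr (rat_num (radius_code k)) = 2^-1 ^+ k :> R.
Proof.
rewrite ratr_rat_num !npairE subr0 prednK ?expn_gt0// natrX exprVn.
by rewrite mul1r.
Qed.

Lemma half_expn_small (R : realType) (e : R) :
  0 < e -> exists k, 2^-1 ^+ k < e.
Proof.
move=> e0; exists (Num.truncn e^-1).+1.
rewrite exprVn invf_plt ?posrE ?exprn_gt0//.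
rewrite (lt_trans (truncnS_gt _))// -natrX ltr_nat.
exact: ltn_expl.
Qed.

Lemma half_expn_le (R : realType) (m n : nat) :
  (m <= n)%N -> 2^-1 ^+ n <= 2^-1 ^+ m :> R.
Proof. by move=> mn; apply: ler_wiXn2l => //; lra. Qed.

Section borel_measures.
Context (R : realType) (X : completeMetricType R).
Implicit Types (P Q : Prob X) (A B : set (borel X)) (x y : X).
Local Notation mdist := (@mdist R X).
Local Open Scope ereal_scope.

Lemma borel_open (A : set X) : open A -> measurable (A : set (borel X)).
Proof. exact: sub_sigma_algebra. Qed.

Lemma open_mdistP (A : set X) :
  open A <-> forall x, A x ->
    exists2 e : R, (0 < e)%R & forall y, (mdist x y < e)%R -> A y.
Proof.
rewrite openE; split=> [oA x /oA /nbhs_ballP[e /= e0 eA]|oA x /oA[e e0 eA]].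
  by exists e => // y xy; apply: eA; rewrite ballEmdist.
by apply/nbhs_ballP; exists e => // y; rewrite ballEmdist; exact: eA.
Qed.

Lemma open_mdist_lt (x : X) (r : R) : open [set y : X | (mdist y x < r)%R].
Proof.
apply/open_mdistP => y /= yx; exists (r - mdist y x)%R => [|z yz].
  by rewrite subr_gt0.
apply: le_lt_trans (metric_triangle z y x) _.
by rewrite metric_sym -ltrBrDr.
Qed.

Lemma open_thickening A (e : R) : open (thickening A e : set X).
Proof.
rewrite (_ : thickening A e =
    \bigcup_(x in A) [set y : X | (mdist y x < e)%R]); last first.
  apply/seteqP; split => y /= [x Ax].
    by rewrite metric_sym => xy; exists x.
  by rewrite /= metric_sym => xy; exists x.
by apply: bigcup_open => x _; exact: open_mdist_lt.
Qed.

Lemma measurable_thickening A (e : R) : measurable (thickening A e).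
Proof. by apply: borel_open; exact: open_thickening. Qed.

Lemma probability_fineK P A : measurable A -> P A = (fine (P A))%:E.
Proof. by move=> mA; rewrite fineK// fin_num_measure. Qed.

Lemma nonincreasing_measure_small P (G : (set (borel X))^nat) (e : R) :
  (forall n, measurable (G n)) -> nonincreasing_seq G ->
  \bigcap_n G n = set0 -> (0 < e)%R -> exists n, P (G n) < e%:E.
Proof.
move=> mG dG G0 e0.
have : P \o G @ \oo --> P (\bigcap_n G n).
  apply: nonincreasing_cvg_mu => //.
    by rewrite -ge0_fin_numE// fin_num_measure.
  by rewrite G0.
rewrite G0 measure0 => /(_ [set z | z < e%:E]) [].
  apply: open_nbhs_nbhs; split; last by rewrite /= lte_fin.
  exact: open_ereal_lt_ereal.
by move=> n _ /(_ n (leqnn n)) /= ?; exists n.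
Qed.

Lemma nondecreasing_measure_small P (F : (set (borel X))^nat) (e : R) :
  (forall n, measurable (F n)) -> nondecreasing_seq F -> (0 < e)%R ->
  exists n, P (\bigcup_n F n `\` F n) < e%:E.
Proof.
move=> mF iF e0.
have mU : measurable (\bigcup_n F n) by exact: bigcupT_measurable.
apply: (@nonincreasing_measure_small P (fun n => \bigcup_n F n `\` F n)) => //.
- by move=> n; exact: measurableD.
- by move=> m n mn; apply/subsetPset; apply: setDS; apply/subsetPset/iF.
- rewrite -subset0 => x Fx; have [[n _ Fnx] _] := Fx 0%N I.
  by have [_] := Fx n I; apply.
Qed.

Lemma le_probability P A B : measurable A -> measurable B ->
  A `<=` B -> P A <= P B.
Proof. by move=> mA mB; apply: le_measure; rewrite inE. Qed.

(** Approximation from inside and outside at once: this two-sided form is stable under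
    complement. *)
Definition closed_open_regular P A := forall e : R, (0 < e)%R ->
  exists F O : set X, [/\ closed F, open O, F `<=` A, A `<=` O &
    P (O `\` F : set (borel X)) < e%:E].

Lemma borel_closed (A : set X) : closed A -> measurable (A : set (borel X)).
Proof.
move=> cA; rewrite -[A]setCK; apply: measurableC.
by apply: borel_open; exact: closed_openC.
Qed.

(** An open set is its own outer approximation and the increasing union of the closed sets of points
    at distance at least [2^-n] from its complement. *)
Lemma open_regular P (A : set X) : open A -> closed_open_regular P A.
Proof.
move=> oA e e0.
pose F n : set X := ~` thickening (~` A) (2^-1 ^+ n).
have FA n : F n `<=` A.
  move=> x; apply: contra_notP => Ax; exists x => //.
  by rewrite mdistxx exprn_gt0.
have [n Pn] : exists n, P (\bigcup_n F n `\` F n : set (borel X)) < e%:E.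
  apply: nondecreasing_measure_small => //.
    by move=> n; apply: measurableC; exact: measurable_thickening.
  move=> m n mn; apply/subsetPset; apply: subsetC => x [y Ay yx].
  exists y => //; apply: lt_le_trans yx _.
  exact: half_expn_le.
exists (F n), A; split => //.
  by apply: open_closedC; exact: open_thickening.
rewrite (_ : A = \bigcup_n F n)//; apply/seteqP; split => x.
  move=> Ax; have [r r0 rA] := (open_mdistP A).1 oA x Ax.
  have [k] := half_expn_small r0.
  move=> kr; exists k => //= -[y Ay yx]; apply: Ay; apply: rA.
  by rewrite metric_sym; exact: lt_trans kr.
by move=> [k _] /FA.
Qed.

Lemma regularC P A : closed_open_regular P A -> closed_open_regular P (~` A).
Proof.
move=> rA e /rA[F [W [cF oW FA AW PFW]]]; exists (~` W), (~` F); split.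
- exact: open_closedC.
- exact: closed_openC.
- exact: subsetC.
- exact: subsetC.
- by rewrite setDE setCK setIC -setDE.
Qed.

(** Half of [e] is spread geometrically over the differences of [O i] and [F i]; the other half pays
    for cutting the union of the [F i], which need not be closed, to a finite one. *)
Lemma regular_bigcup P (A : (set (borel X))^nat) :
  (forall n, closed_open_regular P (A n)) ->
  closed_open_regular P (\bigcup_n A n).
Proof.
move=> rA e e0.
have rA' n : exists FO : set X * set X, [/\ closed FO.1, open FO.2,
    FO.1 `<=` A n, A n `<=` FO.2 &
    P (FO.2 `\` FO.1 : set (borel X)) < (e / 2 / (2 ^ n.+1)%:R)%:E].
  have [|F [W ?]] := rA n (e / 2 / (2 ^ n.+1)%:R)%R; last by exists (F, W).
  by rewrite !divr_gt0// ltr0n expn_gt0.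
have {rA rA'}[FO /all_and5[cF oO FA AO PFO]] := choice rA'.
pose F n := (FO n).1; pose O n := (FO n).2.
pose G n : set (borel X) := \bigcup_(i in `I_n) F i.
have cG n : closed (G n : set X).
  by apply: closed_bigcup => [|i _]; [exact: finite_II|exact: cF].
have GE : \bigcup_n G n = \bigcup_n F n.
  apply/seteqP; split => x [n _].
    by move=> [i _ Fi]; exists i.
  by move=> Fn; exists n.+1 => //; exists n => /=.
have mG n : measurable (G n) by exact: borel_closed.
have [n Pn] : exists n, P (\bigcup_n G n `\` G n) < (e / 2)%:E.
  apply: nondecreasing_measure_small => //; last by rewrite divr_gt0.
  move=> i j ij; apply/subsetPset => x [k /= ki Fk]; exists k => //=.
  exact: leq_trans ij.
have mO i : measurable (O i : set (borel X)) by exact: (borel_open (oO i)).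
have mF i : measurable (F i : set (borel X)) by exact: (borel_closed (cF i)).
have mOF : measurable (\bigcup_i (O i `\` F i) : set (borel X)).
  by apply: bigcupT_measurable => i; exact: measurableD.
have mGG : measurable (\bigcup_n G n `\` G n).
  by apply: measurableD => //; exact: bigcupT_measurable.
exists (G n), (\bigcup_i O i); split => //.
- by apply: bigcup_open => i _; exact: oO.
- by move=> x [i _ /FA]; exists i.
- by move=> x [i _ /AO]; exists i.
apply: (@le_lt_trans _ _ (P ((\bigcup_i (O i `\` F i)) `|`
    (\bigcup_n G n `\` G n)))).
  apply: le_probability.
  - by apply: measurableD => //; apply: bigcupT_measurable.
  - exact: measurableU.
  - move=> x [[i _ Oi] Gn]; have [Fi|Fi] := pselect (F i x).
      by right; split => //; rewrite GE; exists i.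
    by left; exists i.
apply: le_lt_trans (measureU2 _ _ _) _ => //.
rewrite [e]splitr EFinD; apply: lee_ltD => //.
  by rewrite fin_num_measure.
apply: (@le_trans _ _ (\sum_(i <oo) P (O i `\` F i : set (borel X)))).
  apply: measure_sigma_subadditive => //.
  by move=> i; exact: measurableD.
have e2 : (0 <= e / 2)%R by rewrite divr_ge0// ltW.
apply: le_trans (epsilon_trick0 xpredT e2).
by apply: lee_nneseries => // i _; exact/ltW/PFO.
Qed.

(** The regular sets form a sigma-algebra that contains the open sets. *)
Lemma borel_regular P A : measurable A -> closed_open_regular P A.
Proof.
move: A; apply: smallest_sub; last exact: open_regular.
split.
- by move=> e e0; exists set0, set0; split => //;
    rewrite ?setDv ?measure0 ?lte_fin//; [exact: closed0|exact: open0].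
- by move=> A rA; rewrite setTD; exact: regularC.
- by move=> A rA; exact: regular_bigcup.
Qed.

Lemma outer_regular P A (e : R) : measurable A -> P A = 0 -> (0 < e)%R ->
  exists O : set X, [/\ open O, A `<=` O & P (O : set (borel X)) < e%:E].
Proof.
move=> mA PA0 e0.
have [F [W [cF oW FA AW PFW]]] := borel_regular P mA e0.
have mW := borel_open oW; have mF := borel_closed cF.
exists W; split => //; apply: le_lt_trans PFW.
rewrite -[X in _ <= X]add0e -PA0 addeC.
apply: (@le_trans _ _ (P ((W `\` F) `|` A : set (borel X)))).
  apply: le_probability => //.
    by apply: measurableU => //; exact: measurableD.
  by move=> x Wx; have [Ax|Ax] := pselect (A x); [right|left; split => // /FA].
by apply: measureU2 => //; exact: measurableD.
Qed.

End borel_measures.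

(** * The Prokhorov distance and finitely supported measures *)

Section prokhorov_metric.
Context (R : realType) (X : completeMetricType R).
Implicit Types (P Q : Prob X) (A B : set (borel X)) (x y : X).
Local Notation mdist := (@mdist R X).
Local Open Scope ereal_scope.

Lemma le_thickening A (d e : R) :
  (d <= e)%R -> thickening A d `<=` thickening A e.
Proof. by move=> de y [x Ax xy]; exists x => //; exact: lt_le_trans de. Qed.

Lemma prokhorov_has_lbound P Q : has_lbound [set e : R | (0 < e)%R /\
    forall A, measurable A -> P A <= Q (thickening A e) + e%:E /\
      Q A <= P (thickening A e) + e%:E].
Proof. by exists 0%R => e /= [/ltW]. Qed.

(* Applying the inequality to the complement of the thickening of [A] gives
   the symmetric one. *)
Lemma prokhorov_le P Q (e : R) : (0 < e)%R ->
  (forall A, measurable A -> P A <= Q (thickening A e) + e%:E) ->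
  (prokhorov P Q <= e)%R.
Proof.
move=> e0 PQ; apply: ge_inf; first exact: prokhorov_has_lbound.
split => // A mA; split; first exact: PQ.
have mT := measurable_thickening A e.
have := PQ (~` thickening A e) (measurableC mT).
have mT' := measurable_thickening (~` thickening A e) e.
have : Q (thickening (~` thickening A e) e) <= Q (~` A).
  apply: le_probability => //; first exact: measurableC.
  move=> y [x] /= xA xy Ay; apply: xA; exists y => //.
  by rewrite metric_sym.
rewrite !probability_setC// (probability_fineK P mT) (probability_fineK Q mT').
rewrite (probability_fineK Q mA) -!EFinB -!EFinD !lee_fin.
by set a := fine _; set b := fine _; set c := fine _ => ? ?; lra.
Qed.

Lemma prokhorov_le1 P Q : (prokhorov P Q <= 1)%R.
Proof.
apply: prokhorov_le => // A mA; rewrite -[X in X <= _]add0e.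
by apply: leeD => //; exact: probability_le1.
Qed.

Lemma prokhorov_lt P Q (e : R) A : (prokhorov P Q < e)%R -> measurable A ->
  P A <= Q (thickening A e) + e%:E.
Proof.
move=> PQe mA.
(* The value 1 always qualifies, so the infimum is a genuine one and not the default for the empty
   set. *)
have ne : [set e : R | (0 < e)%R /\
    forall A, measurable A -> P A <= Q (thickening A e) + e%:E /\
      Q A <= P (thickening A e) + e%:E] !=set0.
  exists 1%R; split => // B mB; split; rewrite -[X in X <= _]add0e;
    by apply: leeD => //; exact: probability_le1.
have [d [d0 /(_ _ mA)[PA _]] de] := inf_lt ne PQe.
apply: le_trans PA _; apply: leeD; last by rewrite lee_fin ltW.
apply: le_probability; [exact: measurable_thickening..|].
exact: le_thickening (ltW de).
Qed.

Lemma prokhorovC P Q : prokhorov P Q = prokhorov Q P.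
Proof.
rewrite /prokhorov; congr inf; apply/seteqP.
by split => e [e0 PQ]; split => // A /PQ[].
Qed.

End prokhorov_metric.

Lemma atom_entry_surj (k : nat) (F : nat -> nat) :
  exists s, forall i, (i < k)%N -> atom_entry s i = F i.
Proof.
elim: k F => [|k IH] F; first by exists 0%N.
have [s sF] := IH (fun i => F i.+1).
exists (npair (F 0%N) s) => -[_|i ik].
  by rewrite /atom_entry /= nfst_pair.
by rewrite /atom_entry iterSr nsnd_pair; exact: sF.
Qed.

Section finite_support.
Context (R : realType) (X : completeMetricType R) (alpha : nat -> X).
Implicit Types (P Q : Prob X) (A B : set (borel X)) (x y : X).
Local Notation mdist := (@mdist R X).
Local Open Scope ereal_scope.

Lemma finite_measure_of_codeE n A : finite_measure_of_code alpha n A =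
  (weight_in (fun c => `[< A (alpha c) >]) n)%:R%:E.
Proof.
rewrite /finite_measure_of_code /msum /weight_in natr_sum -sumEFin.
apply: eq_bigr => i _; rewrite /= /mscale /= diracE natrM EFinM.
by congr (_ * (nat_of_bool _)%:R%:E).
Qed.

(** A positive total weight excludes the Dirac default of the normalization. *)
Lemma prob_numE n A : (0 < total_weight n)%N -> prob_num alpha n A =
  ((weight_in (fun c => `[< A (alpha c) >]) n)%:R / (total_weight n)%:R)%:E.
Proof.
move=> n0; have -> : prob_num alpha n A =
  (let e := finite_measure_of_code alpha n setT in
   if (e == 0) || (e == +oo) then fun U => @dirac _ (borel X) (alpha 0%N) R U
   else fun U => finite_measure_of_code alpha n U * (fine e)^-1%:E) A by [].
have -> : finite_measure_of_code alpha n setT = (total_weight n)%:R%:E.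
  rewrite finite_measure_of_codeE; congr (_%:R%:E).
  by apply: eq_bigr => i _; rewrite asboolT// muln1.
rewrite /= eqe pnatr_eq0 orbF ifF; last by rewrite eqn0Ngt n0.
by rewrite finite_measure_of_codeE.
Qed.

Lemma leq_weight_in (p q : pred nat) n :
  (forall c, p c -> q c) -> (weight_in p n <= weight_in q n)%N.
Proof.
move=> pq; apply: leq_sum => i _; rewrite leq_mul2l; apply/orP; right.
by have := pq (atom n i); case: (p _) => // ->.
Qed.

Hypothesis alpha_dense : dense (range alpha).

Lemma dense_mdist x (e : R) :
  (0 < e)%R -> exists c, (mdist x (alpha c) < e)%R.
Proof.
move=> e0; have [] := alpha_dense _ (open_mdist_lt x e).
  by exists x; rewrite /= mdistxx.
by move=> y [/= yx [c _ cy]]; exists c; rewrite metric_sym cy.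
Qed.

Let B (e : R) (c : nat) : set (borel X) := [set y | (mdist y (alpha c) < e)%R].

Let mB e c : measurable (B e c).
Proof. by apply: borel_open; exact: open_mdist_lt. Qed.

(** By density the balls of radius [r] at the points [alpha i] exhaust the space, so continuity of
    [P] applies to their finite unions. *)
Lemma measure_finite_cover P (r d : R) : (0 < r)%R -> (0 < d)%R ->
  exists N, P (~` \big[setU/set0]_(i < N) B r i) < d%:E.
Proof.
move=> r0 d0.
pose F n : set (borel X) := \big[setU/set0]_(i < n) B r i.
have mF n : measurable (F n) by exact: bigsetU_measurable.
have iF : nondecreasing_seq F.
  by move=> m n mn; apply/subsetPset; exact: subset_bigsetU.
have [N] := nondecreasing_measure_small P mF iF d0.
rewrite (_ : \bigcup_n F n = setT); first by rewrite setTD; exists N.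
apply/seteqP; split => // x _; have [c xc] := dense_mdist x r0.
by exists c.+1 => //; rewrite /F big_ord_recr; right.
Qed.

(* Rounding the masses of a partition down to multiples of [1 / M] loses at
   most [1 / M] per atom, and normalizing the weights only increases them. *)
Lemma prob_num_dense P (e : R) : (0 < e)%R ->
  exists n, (0 < total_weight n)%N /\ (prokhorov P (prob_num alpha n) < e)%R.
Proof.
(* The minimum with 1 gives [r <= 1/2], which keeps the total weight positive after rounding. *)
move=> e0; pose r : R := (Num.min e 1 / 2)%R.
have r0 : (0 < r)%R by rewrite divr_gt0// lt_min e0 ltr01.
have [re r1] : (r < e /\ 2 * r <= 1)%R.
  have : (Num.min e 1 <= e /\ Num.min e 1 <= 1)%R by rewrite !ge_min !lexx orbT.
  by rewrite /r; lra.
have r20 : (0 < r / 2)%R by rewrite divr_gt0.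
have [N PN] := measure_finite_cover P r0 r20.
pose E := seqDU (B r).
have mE n : measurable (E n) by exact: seqDU_measurable.
pose p n : R := fine (P (E n)).
have p0 n : (0 <= p n)%R by rewrite fine_ge0.
(* Rounding the [N] masses to multiples of [1 / M] then loses at most [r / 2] in all. *)
pose M := (Num.truncn (N%:R / (r / 2))).+1.
have M0 : (0 < M%:R :> R)%R by rewrite ltr0n.
have NM : (N%:R <= r / 2 * M%:R)%R.
  by rewrite mulrC -ler_pdivrMr// ltW// truncnS_gt.
pose w n := Num.truncn (M%:R * p n).
have w_le n : ((w n)%:R <= M%:R * p n)%R.
  by rewrite truncn_le mulr_ge0// ltW.
have w_ge n : (M%:R * p n <= (w n)%:R + 1)%R by rewrite natr1 ltW// truncnS_gt.
have [s sE] := atom_entry_surj N (fun i => npair i (w i)).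
pose n := npair N s.
have wE (i : 'I_N) : weight n i = w i.
  by rewrite /weight nsnd_pair sE// nsnd_pair.
have aE (i : 'I_N) : atom n i = i.
  by rewrite /atom nsnd_pair sE// nfst_pair.
have TE : total_weight n = (\sum_(i < N) w i)%N.
  rewrite /total_weight nfst_pair; apply: eq_bigr => i _; exact: wE.
have wiE q : weight_in q n = (\sum_(i < N) w i * q i)%N.
  by rewrite /weight_in nfst_pair; apply: eq_bigr => i _; rewrite wE aE.
have mU : measurable (\big[setU/set0]_(i < N) B r i).
  exact: bigsetU_measurable.
have SE : P (\big[setU/set0]_(i < N) B r i) = (\sum_(i < N) p i)%:E.
  rewrite bigsetU_seqDU measure_semi_additive_ord_I//; last 2 first.
  - by apply: sub_trivIset (trivIset_seqDU _).
  - by rewrite -bigsetU_seqDU.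
  by rewrite -sumEFin; apply: eq_bigr => i _; rewrite -probability_fineK.
have S1 : (\sum_(i < N) p i <= 1)%R.
  by rewrite -lee_fin -SE; exact: probability_le1.
have S2 : (1 - r / 2 < \sum_(i < N) p i)%R.
  by move: PN; rewrite probability_setC// SE -EFinB lte_fin => ?; lra.
have TM : ((total_weight n)%:R <= M%:R :> R)%R.
  rewrite TE natr_sum; apply: (@le_trans _ _ (\sum_(i < N) M%:R * p i)%R).
    exact: ler_sum.
  by rewrite -mulr_sumr; nra.
have T0 : (0 < total_weight n)%N.
  rewrite -(ltr_nat R) TE natr_sum.
  have : (\sum_(i < N) M%:R * p i <= \sum_(i < N) ((w i)%:R + 1))%R.
    exact: ler_sum.
  rewrite -mulr_sumr big_split/= sumr_const card_ord.
  by set a := (\sum_(_ < _) p _)%R in S1 S2 *; nra.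
exists n; split => //; apply: le_lt_trans re; apply: prokhorov_le => // A mA.
rewrite prob_numE// wiE.
(* A piece [E i] that meets [A] has its center in the thickening. So [A] lies in the selected pieces
   up to the uncovered mass [r / 2], and rounding costs the other [r / 2]. *)
pose sel i := `[< thickening A r (alpha i) >].
pose G i : set (borel X) := if sel i then E i else set0.
have mG i : measurable (G i) by rewrite /G; case: ifP.
have mGU : measurable (\big[setU/set0]_(i < N) G i).
  exact: bigsetU_measurable.
have PA : P A <= P (\big[setU/set0]_(i < N) G i) +
    P (~` \big[setU/set0]_(i < N) B r i).
  apply: le_trans (measureU2 _ _ _) => //; last exact: measurableC.
  apply: le_probability => //.
    by apply: measurableU => //; exact: measurableC.
  move=> x Ax; have [|] := pselect ((\big[setU/set0]_(i < N) B r i) x);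
    last by right.
  rewrite bigsetU_seqDU -!bigcup_mkord => -[i iN Ei]; left; exists i => //.
  rewrite /G ifT//; apply/asboolP; exists x => //.
  by have [] := Ei.
have PG : P (\big[setU/set0]_(i < N) G i) <= (\sum_(i < N) p i * (sel i)%:R)%:E.
  apply: le_trans (Boole_inequality _ _) _ => //.
  rewrite -sumEFin; apply: lee_sum => i _; rewrite /G.
  case: (sel i); first by rewrite mulr1 -probability_fineK.
  by rewrite mulr0 measure0.
apply: le_trans PA _; apply: le_trans (leeD PG (ltW PN)) _.
rewrite -!EFinD lee_fin.
have pw : (\sum_(i < N) p i * (sel i)%:R * M%:R <=
    (\sum_(i < N) w i * sel i)%:R + N%:R :> R)%R.
  rewrite natr_sum -[X in (_ + X%:R)%R](card_ord N) -sum1_card natr_sum.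
  rewrite -big_split/=; apply: ler_sum => i _; rewrite natrM.
  by have := w_ge i; case: (sel i) => /=; nra.
rewrite -mulr_suml in pw.
have wT : ((\sum_(i < N) w i * sel i)%:R / M%:R <=
    (\sum_(i < N) w i * sel i)%:R / (total_weight n)%:R :> R)%R.
  by apply: ler_wpM2l => //; rewrite lef_pV2 ?posrE ?ltr0n.
have pM : (\sum_(i < N) p i * (sel i)%:R <=
    (\sum_(i < N) w i * sel i)%:R / M%:R + r / 2 :> R)%R.
  rewrite -(ler_pM2r M0) mulrDl mulfVK ?gt_eqF//.
  by apply: le_trans pw _; rewrite lerD2l.
by lra.
Qed.

End finite_support.

(** * Separation of orthogonal measures *)

Section separation.
Context (R : realType) (X : completeMetricType R) (alpha : nat -> X).
Hypothesis hX : constructive_metric_space alpha.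
Implicit Types (P Q : Prob X) (A : set (borel X)) (x y : X).
Local Notation mdist := (@mdist R X).
Local Open Scope ereal_scope.

Definition union_balls (I : set nat) (e : R) : set (borel X) :=
  [set y | exists2 c, I c & (mdist y (alpha c) < e)%R].

Lemma open_union_balls I e : open (union_balls I e : set X).
Proof.
rewrite (_ : union_balls I e =
    \bigcup_(c in I) [set y : X | (mdist y (alpha c) < e)%R]) //.
by apply: bigcup_open => c _; exact: open_mdist_lt.
Qed.

Lemma measurable_union_balls I e : measurable (union_balls I e).
Proof. by apply: borel_open; exact: open_union_balls. Qed.

(** The [P]-null set [V] lies in an open [W] of small [P]-measure, and [W] carries all of [Q]. Balls
    of radius [2^-k] whose enlargements by 13 stay in [W] exhaust [W] as [k] grows, and finitely
    many of them suffice up to [d]. The factor 13 is the room that [separates_ex] consumes. *)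
Lemma orthogonal_separation P Q (M : nat) (d : R) :
  orthogonal_measures P Q -> (0 < d)%R ->
  exists k (s : seq nat), [/\ (M <= k)%N,
    P (union_balls [set` s] (13 * 2^-1 ^+ k)) < d%:E &
    Q (~` union_balls [set` s] (2^-1 ^+ k)) < d%:E].
Proof.
move=> [U [V [mU mV UV _ [PV QU]]]] d0.
have d20 : (0 < d / 2)%R by rewrite divr_gt0.
have [W [oW VW PW]] := outer_regular mV PV d0.
have mW := borel_open oW.
pose J k := [set c : nat |
  [set y : X | (mdist y (alpha c) < 13 * 2^-1 ^+ k)%R] `<=` W].
pose H n := union_balls (J (n + M)%N) (2^-1 ^+ (n + M)).
have mH n : measurable (H n) by exact: measurable_union_balls.
have iH : nondecreasing_seq H.
  apply/nondecreasing_seqP => n; apply/subsetPset => y [c Jc yc].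
  have e0 : (0 < 2^-1 ^+ (n.+1 + M) :> R)%R by rewrite exprn_gt0.
  have [c' yc'] := dense_mdist (alpha_dense hX) y e0.
  (* With [u] the new radius and [v = 2 u] the old one, the ball of radius [13 u] at [c'] lies
     within [13 u + u + v = 8 v] of [c]. *)
  exists c' => // z /= zc'; apply: Jc => /=.
  have t1 := metric_triangle z (alpha c') (alpha c).
  have t2 := metric_triangle (alpha c') y (alpha c).
  rewrite (metric_sym (alpha c') y) in t2.
  have := exprS (2^-1 : R) (n + M); rewrite addSn in e0 yc' zc' *.
  by set u := (_ ^+ _)%R in e0 yc' zc' *; set v := (_ ^+ _)%R in yc *; lra.
have HE : \bigcup_n H n = W.
  apply/seteqP; split => x.
    move=> [n _ [c Jc xc]]; apply: Jc => /=; apply: lt_trans xc _.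
    by rewrite ltr_pMl ?exprn_gt0//; lra.
  move=> Wx; have [e e0 eW] := (open_mdistP W).1 oW x Wx.
  (* Here 14 is 13 + 1: the enlarged ball at a center within one radius of [x] stays in the [e]-ball
     at [x]. *)
  have [n] := half_expn_small (divr_gt0 e0 (ltr0n R 14)).
  rewrite ltr_pdivlMr// => ne; exists n => //.
  have u0 : (0 < 2^-1 ^+ (n + M) :> R)%R by rewrite exprn_gt0.
  have [c xc] := dense_mdist (alpha_dense hX) x u0.
  exists c => // y /= yc; apply: eW.
  have := metric_triangle x (alpha c) y; rewrite (metric_sym (alpha c) y).
  have : (2^-1 ^+ (n + M) <= 2^-1 ^+ n :> R)%R by apply: half_expn_le; lia.
  by set u := (_ ^+ _)%R in xc yc u0 *; set v := (_ ^+ _)%R in ne *; lra.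
have [n Pn] := nondecreasing_measure_small Q mH iH d20.
rewrite HE in Pn.
(* Bounding the index makes the list finite; the second [d / 2] pays for this truncation, the first
   one paid for the choice of scale. *)
pose I i := [set c | (c < i)%N /\ J (n + M)%N c].
pose G i := union_balls (I i) (2^-1 ^+ (n + M)).
have mG i : measurable (G i) by exact: measurable_union_balls.
have iG : nondecreasing_seq G.
  move=> i j ij; apply/subsetPset => y [c [ci Jc] yc]; exists c => //.
  by split => //; exact: leq_trans ij.
have GE : \bigcup_i G i = H n.
  apply/seteqP; split => x.
    by move=> [i _ [c [_ Jc] xc]]; exists c.
  by move=> [c Jc xc]; exists c.+1 => //; exists c => //; split.
have [N PN] := nondecreasing_measure_small Q mG iG d20.
rewrite GE in PN.
exists (n + M)%N, [seq c <- iota 0 N | `[< J (n + M)%N c >]].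
have -> : [set` [seq c <- iota 0 N | `[< J (n + M)%N c >]]] = I N.
  apply/seteqP; split => c /=; rewrite mem_filter mem_iota add0n.
    by move=> /andP[/asboolP Jc].
  by move=> [cN Jc]; rewrite cN asboolT.
split; first by rewrite leq_addl.
  apply: le_lt_trans PW; apply: le_probability => //.
    exact: measurable_union_balls.
  by move=> y [c [_ Jc] yc]; exact: Jc.
have mWH : measurable (W `\` H n : set (borel X)) by exact: measurableD.
have mHG : measurable (H n `\` G N) by exact: measurableD.
rewrite [d]splitr EFinD; apply: le_lt_trans (lteD Pn PN).
rewrite -[X in _ <= X]add0e -QU.
(* A point outside the [Q]-null set [U] is in [V], hence in [W]; if [G N] misses it, it was lost at
   the scale or at the truncation. *)
apply: (@le_trans _ _ (Q (U `|` ((W `\` H n) `|` (H n `\` G N))))).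
  apply: le_probability.
  - by apply: measurableC; exact: mG.
  - by apply: measurableU => //; exact: measurableU.
  move=> x Gx; have [Hx|Hx] := pselect (H n x); first by right; right.
  have [Wx|Wx] := pselect (W x); first by right; left.
  by left; have : (U `|` V) x by [rewrite UV]; case=> // /VW.
apply: le_trans (measureU2 _ _ _) _ => //; first exact: measurableU.
by apply: leeD => //; exact: measureU2.
Qed.

Variable delta : nat -> nat.
Hypothesis deltaP : forall m n k, (`| mdist (alpha m) (alpha n) -
  ratr (rat_num (delta (npair (npair m n) k))) | <= 2^-1 ^+ k)%R.

Definition centers (I : nat) : set nat :=
  [set c | exists2 j, (j < nfst I)%N & atom_entry (nsnd I) j = c].

Lemma centers_surj (s : seq nat) : exists I, centers I = [set` s].
Proof.
have [t tE] := atom_entry_surj (size s) (nth 0%N s).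
exists (npair (size s) t); rewrite /centers npairE nsnd_pair.
apply/seteqP; split => c /=.
  by move=> [j js <-]; rewrite tE// mem_nth.
move=> cs; exists (index c s); first by rewrite index_mem.
by rewrite tE ?index_mem// nth_index.
Qed.

Lemma near_centerP L k I a : reflect
  (exists2 c, centers I c &
     (ratr (rat_num (delta (npair (npair a c) k))) < L%:R * 2^-1 ^+ k :> R)%R)
  (near_center delta L k I a).
Proof.
apply: (iffP hasP) => [[j]|[_ [j jI <-] dj]].
  rewrite mem_iota add0n => /= jI dj.
  by exists (atom_entry (nsnd I) j); [exists j|rewrite rat_num_ltE].
by exists j; [rewrite mem_iota|rewrite /= -(rat_num_ltE R)].
Qed.

(** Passing from approximate to true distances costs one unit of [L], the error of [delta]; so does
    the way back in [union_balls_near_center]. *)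
Lemma near_center_union_balls L k I a : near_center delta L k I a ->
  union_balls (centers I) (L.+1%:R * 2^-1 ^+ k) (alpha a).
Proof.
move=> /near_centerP[c Ic ac]; exists c => //.
have := deltaP a c k; rewrite ler_distlC => /andP[+ _].
by rewrite -[L.+1%:R]natr1 mulrDl mul1r; lra.
Qed.

Lemma union_balls_near_center L k I a :
  union_balls (centers I) (L%:R * 2^-1 ^+ k) (alpha a) ->
  near_center delta L.+1 k I a.
Proof.
move=> [c Ic ac]; apply/near_centerP; exists c => //.
have := deltaP a c k; rewrite ler_distlC => /andP[_].
by rewrite -[L.+1%:R]natr1 mulrDl mul1r; lra.
Qed.

(** By the Prokhorov bound, [P] of the union is at most [2^-k] plus the mass of the atoms within
    [2 * 2^-k] of a center in [S], all counted by [T]; both terms are at most [2^-M]. *)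
Lemma weight_in_sound P (S T : pred nat) n k M :
  (forall a c, S c -> (mdist (alpha a) (alpha c) < 2 * 2^-1 ^+ k)%R -> T a) ->
  (0 < total_weight n)%N -> (weight_in T n * 2 ^ M <= total_weight n)%N ->
  (M <= k)%N -> (prokhorov P (prob_num alpha n) < 2^-1 ^+ k)%R ->
  P (union_balls [set c | S c] (2^-1 ^+ k)) <= (2 * 2^-1 ^+ M)%:E.
Proof.
move=> ST n0 wT Mk Pn.
apply: le_trans (prokhorov_lt Pn (measurable_union_balls _ _)) _.
have -> : (2 * 2^-1 ^+ M = 2^-1 ^+ M + 2^-1 ^+ M :> R)%R by lra.
rewrite prob_numE// -EFinD lee_fin; apply: lerD.
  rewrite ler_pdivrMr ?ltr0n// (exprVn _ M) [X in (_ <= X)%R]mulrC.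
  rewrite ler_pdivlMr ?exprn_gt0//.
  rewrite -natrX -natrM ler_nat; apply: leq_trans wT.
  rewrite leq_mul2r; apply/orP; right; apply: leq_weight_in => a /asboolP.
  move=> [x [c Sc xc] xa]; apply: (ST a c) => //.
  have := metric_triangle (alpha a) x (alpha c).
  by rewrite (metric_sym (alpha a) x); lra.
exact: half_expn_le.
Qed.

(** The Prokhorov bound in the other direction: the mass of [G] is at most [P H + 2^-k], two terms
    bounded by [2^-(M+1)]. *)
Lemma weight_in_complete P (T : pred nat) (G H : set (borel X)) n k M :
  (forall a, T a -> G (alpha a)) -> thickening G (2^-1 ^+ k) `<=` H ->
  measurable G -> measurable H -> P H < (2^-1 ^+ M.+1)%:E -> (M.+1 <= k)%N ->
  (0 < total_weight n)%N -> (prokhorov P (prob_num alpha n) < 2^-1 ^+ k)%R ->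
  (weight_in T n * 2 ^ M <= total_weight n)%N.
Proof.
move=> TG GH mG mH PH Mk n0; rewrite prokhorovC => /prokhorov_lt/(_ mG) nG.
have {PH}nG : prob_num alpha n G < (2^-1 ^+ M)%:E.
  apply: le_lt_trans nG _.
  rewrite (_ : (2^-1 ^+ M)%R = (2^-1 ^+ M.+1 + 2^-1 ^+ M.+1)%R).
    rewrite EFinD; apply: lte_leD => //; last by rewrite lee_fin half_expn_le.
    apply: le_lt_trans PH; apply: le_probability => //.
    exact: measurable_thickening.
  by rewrite exprS; lra.
rewrite -(ler_nat R) natrM natrX.
move: nG; rewrite prob_numE// lte_fin ltr_pdivrMr ?ltr0n// exprVn mulrC.
rewrite ltr_pdivlMr ?exprn_gt0// => /ltW; apply: le_trans.
apply: ler_wpM2r; first by rewrite exprn_ge0.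
by rewrite ler_nat; apply: leq_weight_in => a /TG ?; exact/asboolP.
Qed.

End separation.

(** * Uniform tests *)

Section tests.
Context (R : realType) (X : completeMetricType R) (alpha : nat -> X).
Implicit Types (P Q : Prob X) (x y : X) (f : X -> Prob X -> \bar R).
Local Notation mdist := (@mdist R X).
Local Open Scope ereal_scope.

(** At fixed [P] the product balls have balls of [X] or the empty set as sections, so rational
    superlevel sets are open; a real threshold is the union over the rationals not below it. *)
Lemma lower_semicomputable_measurable f P :
  lower_semicomputable alpha f ->
  measurable_fun [set: borel X] (f^~ P : borel X -> \bar R).
Proof.
move=> [W _ fW] mT.
apply: (measurability _ (ErealGenOInfty.measurableE R)) => //.
move=> _ [_ [y ->] <-]; rewrite setTI.
rewrite [X in measurable X](_ : _ =
    \bigcup_(r in [set r | (y <= ratr (rat_num r))%R])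
      [set x : borel X | (ratr (rat_num r))%:E < f x P]); last first.
  apply/seteqP; split => x /=; rewrite in_itv /= andbT.
    move=> yf; have [v yv vf] : exists2 v : R, (y < v)%R & v%:E <= f x P.
      case: (f x P) yf => [v yv|_|//]; first by exists v.
      by exists (y + 1)%R; rewrite ?ltrDl// leey.
    have [q] := rat_in_itvoo yv; rewrite in_itv/= => /andP[yq qv].
    have [r rq] := rat_num_surj q.
    exists r; rewrite /= rq; first exact: ltW.
    by apply: lt_le_trans vf; rewrite lte_fin.
  by move=> [r /= yr]; apply: le_lt_trans; rewrite lee_fin.
apply: bigcup_measurable => r _; apply: borel_open.
rewrite (_ : mkset _ = \bigcup_(n in [set n | W (npair r n) /\
    basic_ball (@prokhorov R X) (prob_num alpha) (nsnd n) P])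
    basic_ball mdist alpha (nfst n)).
  by apply: bigcup_open => n _; exact: open_mdist_lt.
apply/seteqP; split => x /=.
  move=> rf; have : [set xP : X * Prob X |
      (ratr (rat_num r))%:E < f xP.1 xP.2] (x, P) by [].
  by rewrite fW => -[n Wn [/= xn Pn]]; exists n.
move=> [n [Wn Pn] xn]; have : (\bigcup_(n in [set n | W (npair r n)])
    (basic_ball mdist alpha (nfst n) `*`
     basic_ball (@prokhorov R X) (prob_num alpha) (nsnd n))) (x, P) by exists n.
by rewrite -fW.
Qed.

(** An integrable function is finite almost everywhere. *)
Lemma uniform_test_null f P : uniform_test alpha f ->
  measurable [set x : borel X | f x P = +oo] /\
  P [set x : borel X | f x P = +oo] = 0.
Proof.
move=> [f0 lf intf]; have mf := lower_semicomputable_measurable P lf.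
have mE : measurable [set x : borel X | f x P = +oo].
  have := emeasurable_fun_c_infty measurableT mf +oo; rewrite setTI.
  congr measurable; apply/seteqP.
  by split => x /=; rewrite leye_eq => /eqP.
split => //.
have : P.-integrable setT (fun x : borel X => f x P).
  apply/integrableP; split => //.
  under eq_integral do rewrite gee0_abs//.
  by apply: le_lt_trans (intf P) _; rewrite ltry.
move=> /integrable_ae[//|N [mN PN0 fN]].
apply/eqP; rewrite eq_le measure_ge0 andbT -PN0.
by apply: le_probability => // x /= fx; apply: fN => /= /(_ I); rewrite fx.
Qed.

Lemma effectively_orthogonal_orthogonal t P Q : uniform_test alpha t ->
  effectively_orthogonal t P Q -> orthogonal_measures P Q.
Proof.
move=> ut tPQ; have [mP P0] := uniform_test_null P ut.
have [mQ Q0] := uniform_test_null Q ut.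
exists (~` [set x : borel X | t x P = +oo]), [set x : borel X | t x P = +oo].
split => //; first exact: measurableC.
- by rewrite setUC setUv.
- by rewrite setIC setICr.
split => //; apply/eqP; rewrite eq_le measure_ge0 andbT -Q0.
apply: le_probability => //; first exact: measurableC.
(* A point with [t x P] finite and [t x Q] finite would be random for both measures. *)
move=> x /= tP; apply: contrapT => tQ; apply: tPQ; exists x.
by split; rewrite /uniformly_random ltey; apply/eqP.
Qed.

(** * The test defined by a recursive sequence of small open sets *)

Section sup_test.
Variables (k b : nat -> nat) (S : nat -> pred nat).
Hypothesis rk : recursive k.
Hypothesis rb : recursive b.
Hypothesis rS : recursive (fun z => S (nfst z) (nsnd z)).

Let A m := union_balls alpha [set c | S m c] (2^-1 ^+ k m).
Let mball m := basic_ball (@prokhorov R X) (prob_num alpha) (b m).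

Hypothesis mballA :
  forall m P, mball m P -> P (A m) <= (2^-1 ^+ (2 * m + 1))%:E.

(** Adjoining 0 keeps the supremum from being [-oo] when no [m] qualifies. *)
Definition sup_test x P : \bar R :=
  ereal_sup (0 |` [set m%:R%:E | m in [set m | A m x /\ mball m P]]).

Lemma sup_test_ge0 x P : 0 <= sup_test x P.
Proof. by apply: ereal_sup_ubound; left. Qed.

Lemma sup_test_ge m x P : A m x -> mball m P -> m%:R%:E <= sup_test x P.
Proof. by move=> Ax bP; apply: ereal_sup_ubound; right; exists m. Qed.

Lemma sup_test_gt0 (r : R) x P : (0 <= r)%R -> r%:E < sup_test x P ->
  exists m, [/\ (r < m%:R)%R, A m x & mball m P].
Proof.
move=> r0 /ereal_sup_gt[_ [->|[m [Am bm] <-]]].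
  by rewrite lte_fin ltNge r0.
by rewrite lte_fin => rm; exists m.
Qed.

(** For [w = <r, <i, j>>]: a negative threshold [r] accepts every pair of balls; otherwise [m] must
    exceed it, with [i] one of the balls composing [A m] and [j] the ball [b m]. *)
Let chi w m : bool :=
  let r := nfst w in let i := nfst (nsnd w) in let j := nsnd (nsnd w) in
  (nfst (nfst r) < nsnd (nfst r))%N ||
  [&& (nfst (nfst r) < nsnd (nfst r) + m * (nsnd r).+1)%N,
      nsnd i == radius_code (k m), S m (nfst i) & j == b m].

Let recursive_chi : recursive (fun z => chi (nfst z) (nsnd z)).
Proof.
have r1 := recursive_nfst recursive_fst.
have r2 := recursive_nsnd recursive_fst.
have ri := recursive_nfst r2.
have rfr := recursive_nfst (recursive_nfst r1).
have rsr := recursive_nsnd (recursive_nfst r1).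
apply: recursive_orb; first exact: recursive_leq (recursive_S rfr) rsr.
apply: recursive_andb.
  apply: recursive_leq (recursive_S rfr) (recursive_add rsr _).
  exact: recursive_mul recursive_snd (recursive_S (recursive_nsnd r1)).
apply: recursive_andb.
  apply: recursive_eqn; first exact: recursive_nsnd.
  by apply: recursive_radius_code; exact: recursive_comp rk recursive_snd.
apply: recursive_andb.
  have := recursive_comp rS (recursive_pair recursive_snd (recursive_nfst ri)).
  by apply: eq_recursive => y; rewrite !npairE.
apply: recursive_eqn; first exact: recursive_nsnd.
exact: recursive_comp rb recursive_snd.
Qed.

Lemma rat_num_lt0E r : (ratr (rat_num r) < 0 :> R)%R =
  (nfst (nfst r) < nsnd (nfst r))%N.
Proof. by rewrite ratr_rat_num pmulr_llt0 ?invr_gt0// subr_lt0 ltr_nat. Qed.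

Lemma rat_num_lt_natE r m : (ratr (rat_num r) < m%:R :> R)%R =
  (nfst (nfst r) < nsnd (nfst r) + m * (nsnd r).+1)%N.
Proof.
by rewrite ratr_rat_num ltr_pdivrMr// ltrBlDl -natrM -natrD ltr_nat.
Qed.

Lemma sup_test_lsc : lower_semicomputable alpha sup_test.
Proof.
exists [set w | exists m, chi w m].
  (* The default member has threshold [-1], so the first disjunct of [chi] holds. *)
  apply: (@enumerable_ex chi (npair (npair (npair 0 1) 0) 0)) => //.
  by exists 0%N; rewrite /chi !npairE.
move=> r; apply/seteqP; split => -[x P] /=.
  have [r0|r0] := ltP (ratr (rat_num r) : R)%R 0%R => rf.
    (* For a negative threshold any product ball around [(x, P)] will do: radius [N] in [X], and
       radius 2 for measures, whose distances are at most 1. *)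
    pose N := (Num.truncn (mdist x (alpha 0%N))).+1.
    exists (npair (npair 0 (npair (npair N 0) 0))
                  (npair 0 (npair (npair 2 0) 0))).
      by exists 0%N; rewrite /chi !npairE -rat_num_lt0E r0.
    split; rewrite /basic_ball/= ratr_rat_num !npairE subr0 divr1.
      exact: truncnS_gt.
    by apply: le_lt_trans (prokhorov_le1 _ _) _; rewrite ltr1n.
  have [m [rm [c Sc xc] bP]] := sup_test_gt0 r0 rf.
  exists (npair (npair c (radius_code (k m))) (b m)).
    exists m; rewrite /chi !npairE -rat_num_lt_natE rm eqxx eqxx andbT /=.
    by rewrite (Sc : S m c) orbT.
  by split; rewrite /= !npairE// /basic_ball /= !npairE ratr_radius_code.
move=> [n [m] + [xn Pn]].
rewrite /chi !npairE -rat_num_lt0E -rat_num_lt_natE => /orP[r0|].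
  by apply: lt_le_trans (sup_test_ge0 _ _); rewrite lte_fin.
move=> /and4P[rm /eqP ik Si /eqP jb].
apply: (@lt_le_trans _ _ m%:R%:E); first by rewrite lte_fin.
apply: sup_test_ge; last by rewrite /mball -jb.
exists (nfst (nfst n)) => //.
by move: xn; rewrite /basic_ball /= ik ratr_radius_code.
Qed.

(** The supremum is at most the sum of its terms; the term [m] integrates to at most
    [m * 2^-(2m+1) <= 2^-(m+1)], and these bounds sum to 1. *)
Lemma sup_test_int P : \int[P]_(x in [set: borel X]) sup_test x P <= 1.
Proof.
have mA m : measurable (A m) by exact: measurable_union_balls.
pose g m (x : borel X) : \bar R :=
  if `[< mball m P >] then m%:R%:E * (\1_(A m) x)%:E else 0.
have g0 m x : 0 <= g m x.
  by rewrite /g; case: ifP => // _; rewrite mule_ge0// lee_fin.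
have mg m : measurable_fun setT (g m).
  rewrite /g; case: `[< mball m P >]; last exact: measurable_cst.
  apply: measurable_funeM; apply/measurable_EFinP.
  exact: measurable_indic.
apply: (@le_trans _ _ (\int[P]_(x in [set: borel X]) (\sum_(m <oo) g m x))).
  apply: ge0_le_integral => //.
  - by move=> x _; exact: sup_test_ge0.
  - exact: lower_semicomputable_measurable sup_test_lsc.
  - by apply: ge0_emeasurable_sum => //.
  move=> x _; apply: ub_ereal_sup => _ [->|[m [Am bm] <-]].
    exact: nneseries_ge0.
  rewrite (nneseriesD1 (n := m))// {1}/g asboolT// indicE mem_set// mule1.
  by rewrite leeDl// nneseries_ge0.
rewrite integral_nneseries//.
apply: le_trans (epsilon_trick0 xpredT ler01).
apply: lee_nneseries => [m _ _|m _]; first exact: integral_ge0.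
rewrite /g; case: asboolP => bm; last first.
  by rewrite integral0 lee_fin divr_ge0.
rewrite ge0_integralZl//; last first.
  by apply/measurable_EFinP; exact: measurable_indic.
rewrite integral_indic// setIT.
apply: (@le_trans _ _ (m%:R%:E * (2^-1 ^+ (2 * m + 1))%:E)).
  by apply: lee_wpmul2l; [rewrite lee_fin|exact: mballA].
rewrite -EFinM lee_fin mul1r natrX -exprVn.
rewrite (_ : 2 * m + 1 = m + m.+1)%N; last lia.
rewrite exprD mulrA ler_piMl ?exprn_ge0// exprVn ler_pdivrMr ?exprn_gt0//.
by rewrite mul1r -natrX ler_nat ltnW// ltn_expl.
Qed.

Lemma sup_test_uniform : uniform_test alpha sup_test.
Proof.
split; [exact: sup_test_ge0|exact: sup_test_lsc|exact: sup_test_int].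
Qed.

End sup_test.

End tests.

(** * Effective separation *)

Section witnesses.
Local Open Scope nat_scope.
Variables (delta p q : nat -> nat).

(* A witness [<k, <I, <u, v>>>] consists of a scale [2^-k], a list of centers
   [I] and balls [p u], [q v] of measures, of radius [2^-k].  The weights bound,
   uniformly over these balls, the measure of the union of the balls of radius
   [2^-k] at the points that are (resp. are not) [7 * 2^-k]-near to [I]. *)
Definition separates (m z : nat) : bool :=
  let k := nfst z in let I := nfst (nsnd z) in
  let b := p (nfst (nsnd (nsnd z))) in let c := q (nsnd (nsnd (nsnd z))) in
  [&& nsnd b == radius_code k, nsnd c == radius_code k, 2 * m + 2 <= k,
      0 < total_weight (nfst b), 0 < total_weight (nfst c),
      weight_in (near_center delta 11 k I) (nfst b) * 2 ^ (2 * m + 2)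
        <= total_weight (nfst b) &
      weight_in (fun a => ~~ near_center delta 3 k I a) (nfst c)
        * 2 ^ (2 * m + 2) <= total_weight (nfst c)].

Lemma recursive_separates : recursive delta -> recursive p -> recursive q ->
  recursive (fun y => separates (nfst y) (nsnd y)).
Proof.
move=> rd rp rq.
have rk := recursive_nfst recursive_snd.
have r2 := recursive_nsnd recursive_snd.
have rI := recursive_nfst r2.
have rb := recursive_comp rp (recursive_nfst (recursive_nsnd r2)).
have rc := recursive_comp rq (recursive_nsnd (recursive_nsnd r2)).
have rM := recursive_add (recursive_mul (recursive_const 2) recursive_fst)
  (recursive_const 2).
have rr := recursive_radius_code rk.
have rn L := recursive_near_center rd L (recursive_comp rk recursive_fst)
  (recursive_comp rI recursive_fst) recursive_snd.
have rtb := recursive_total_weight (recursive_nfst rb).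
have rtc := recursive_total_weight (recursive_nfst rc).
apply: recursive_andb; first exact: recursive_eqn (recursive_nsnd rb) rr.
apply: recursive_andb; first exact: recursive_eqn (recursive_nsnd rc) rr.
apply: recursive_andb; first exact: recursive_leq rM rk.
apply: recursive_andb; first exact: recursive_leq (recursive_const 1) rtb.
apply: recursive_andb; first exact: recursive_leq (recursive_const 1) rtc.
apply: recursive_andb; apply: recursive_leq => //;
    apply: recursive_mul (recursive_exp2 rM).
  apply: (@recursive_weight_in (fun y => near_center delta 11 (nfst (nsnd y))
    (nfst (nsnd (nsnd y))))); [exact: rn|exact: recursive_nfst].
apply: (@recursive_weight_in (fun y a => ~~ near_center delta 3 (nfst (nsnd y))
    (nfst (nsnd (nsnd y))) a)); last exact: recursive_nfst.
exact: recursive_negb (rn 3).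
Qed.

End witnesses.

Section effective_separation.
Context (R : realType) (X : completeMetricType R) (alpha : nat -> X).
Hypothesis hX : constructive_metric_space alpha.
Variable delta : nat -> nat.
Hypothesis deltaP : forall m n k, (`| mdist (alpha m) (alpha n) -
  ratr (rat_num (delta (npair (npair m n) k))) | <= 2^-1 ^+ k :> R)%R.
Variables (P Q : Prob X) (p q : nat -> nat).
Local Notation mball := (basic_ball (@prokhorov R X) (prob_num alpha)).
Hypothesis pP : range p = [set n | mball n P].
Hypothesis qQ : range q = [set n | mball n Q].

(** In units of [2^-k]: passing test 11 means distance below 12 from a center, and thickening
    reaches 13; failing test 3 means distance at least 2 from all centers, and thickening leaves at
    least 1. *)
Lemma separates_ex : orthogonal_measures P Q ->
  forall m, exists z, separates delta p q m z.
Proof.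
move=> PQ m; pose M := (2 * m + 2)%N.
have d0 : 0 < 2^-1 ^+ M.+1 :> R by rewrite exprn_gt0.
have [k [s [Mk Ps Qs]]] := orthogonal_separation hX M.+1 PQ d0.
have [I Is] := centers_surj s; rewrite -Is in Ps Qs.
have k0 : 0 < 2^-1 ^+ k :> R by rewrite exprn_gt0.
have [b [b0 Pb]] := prob_num_dense (alpha_dense hX) P k0.
have [c [c0 Qc]] := prob_num_dense (alpha_dense hX) Q k0.
have [u _ uE] : range p (npair b (radius_code k)).
  by rewrite pP /= /basic_ball/= !npairE ratr_radius_code.
have [v _ vE] : range q (npair c (radius_code k)).
  by rewrite qQ /= /basic_ball/= !npairE ratr_radius_code.
exists (npair k (npair I (npair u v))).
rewrite /separates !npairE uE vE !npairE !eqxx b0 c0 (ltnW Mk) /=.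
apply/andP; split.
  apply: (@weight_in_complete _ _ alpha P _
    (union_balls alpha (centers I) (12%:R * 2^-1 ^+ k))
    (union_balls alpha (centers I) (13 * 2^-1 ^+ k)) _ k) => //;
    try exact: measurable_union_balls.
    by move=> a /(near_center_union_balls deltaP).
  move=> y [x [i Ii xi] xy]; exists i => //.
  have := metric_triangle y x (alpha i); rewrite (metric_sym y x).
  by lra.
apply: (@weight_in_complete _ _ alpha Q _
  (~` union_balls alpha (centers I) (2%:R * 2^-1 ^+ k))
  (~` union_balls alpha (centers I) (2^-1 ^+ k)) _ k) => //;
  try (apply: measurableC; exact: measurable_union_balls).
  by move=> a; apply: contraNnot => /(union_balls_near_center deltaP).
move=> y [x xI xy] [i Ii yi]; apply: xI; exists i => //.
by have := metric_triangle x y (alpha i); lra.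
Qed.

(** The gaps around 7 absorb a move by 2 units of [2^-k] and two errors of [delta]: passing test 7
    gives distance below 8, then 10, hence test 11; passing test 3 gives 4, then 6, hence test 7. *)
Lemma separates_sound m z (P' : Prob X) : separates delta p q m z ->
  let k := nfst z in let I := nfst (nsnd z) in
  (mball (p (nfst (nsnd (nsnd z)))) P' ->
   (P' (union_balls alpha [set c | near_center delta 7 k I c] (2^-1 ^+ k))
     <= (2^-1 ^+ (2 * m + 1))%:E)%E) /\
  (mball (q (nsnd (nsnd (nsnd z)))) P' ->
   (P' (union_balls alpha [set c | ~~ near_center delta 7 k I c] (2^-1 ^+ k))
     <= (2^-1 ^+ (2 * m + 1))%:E)%E).
Proof.
rewrite /separates; set k := nfst z; set I := nfst (nsnd z).
set b := p _; set c := q _ => /and5P[/eqP bk /eqP ck mk b0 /and3P[c0 bw cw]] /=.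
have -> : 2^-1 ^+ (2 * m + 1) = 2 * 2^-1 ^+ (2 * m + 2) :> R.
  by rewrite addn2 addn1 [in RHS]exprS mulrA divff// mul1r.
rewrite /basic_ball /= bk ck ratr_radius_code.
split=> [Pb|Pc].
  apply: (weight_in_sound (S := near_center delta 7 k I) _ b0 bw mk Pb).
  move=> a e /(near_center_union_balls deltaP)[i Ii ei] ae.
  apply: (union_balls_near_center deltaP); exists i => //.
  by have := metric_triangle (alpha a) (alpha e) (alpha i); lra.
apply: (weight_in_sound (S := fun c => ~~ near_center delta 7 k I c)
  _ c0 cw mk Pc).
move=> a e; rewrite (metric_sym (alpha a)); move=> + ae; apply: contra.
move=> /(near_center_union_balls deltaP)[i Ii ai].
apply: (union_balls_near_center deltaP); exists i => //.
by have := metric_triangle (alpha e) (alpha a) (alpha i); lra.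
Qed.

End effective_separation.

(** * Orthogonality and effective orthogonality *)

Lemma enumerable_range (S : set nat) : enumerable S -> S !=set0 ->
  exists2 f, recursive f & range f = S.
Proof. by move=> [->|//] /set0P; rewrite eqxx. Qed.

(** A ball of radius 2 contains every measure, so the enumerable set of balls around [P] is nonempty
    and is a range. *)
Lemma computable_measure_balls (R : realType) (X : completeMetricType R)
    (alpha : nat -> X) (P : Prob X) : computable_measure alpha P ->
  exists2 p, recursive p &
    range p = [set n | basic_ball (@prokhorov R X) (prob_num alpha) n P].
Proof.
move=> /enumerable_range; apply.
exists (npair 0 (npair (npair 2 0) 0)).
rewrite /= /basic_ball/= !npairE ratr_rat_num !npairE subr0 divr1.
by apply: le_lt_trans (prokhorov_le1 _ _) _; rewrite ltr1n.
Qed.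

Lemma orthogonal_effectively_orthogonal (R : realType)
    (X : completeMetricType R) (alpha : nat -> X)
    (hX : constructive_metric_space alpha)
    (t : X -> Prob X -> \bar R) (ht : universal_uniform_test alpha t)
    (P Q : Prob X)
    (hP : computable_measure alpha P) (hQ : computable_measure alpha Q) :
  orthogonal_measures P Q -> effectively_orthogonal t P Q.
Proof.
move=> PQ [x [tP tQ]].
have [p rp pP] := computable_measure_balls hP.
have [q rq qQ] := computable_measure_balls hQ.
have [delta rd deltaP] := alpha_computable hX.
have [h rh hsep] := recursive_selection (recursive_separates rd rp rq)
  (separates_ex hX deltaP pP qQ PQ).
pose k m := nfst (h m); pose I m := nfst (nsnd (h m)).
pose b m := p (nfst (nsnd (nsnd (h m)))).
pose c m := q (nsnd (nsnd (nsnd (h m)))).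
pose S m := near_center delta 7 (k m) (I m).
pose S' m a := ~~ S m a.
have rk : recursive k by exact: recursive_nfst.
have r2 := recursive_nsnd rh.
have rI : recursive I by exact: recursive_nfst.
have rb : recursive b.
  exact: (recursive_comp rp (recursive_nfst (recursive_nsnd r2))).
have rc : recursive c.
  exact: (recursive_comp rq (recursive_nsnd (recursive_nsnd r2))).
have rS : recursive (fun y => S (nfst y) (nsnd y)).
  exact: (recursive_near_center rd 7 (recursive_comp rk recursive_fst)
    (recursive_comp rI recursive_fst) recursive_snd).
have rS' := recursive_negb rS.
have uP := sup_test_uniform rk rb rS
  (fun m P' => (separates_sound deltaP P' (hsep m)).1).
have uQ := sup_test_uniform (S := S') rk rc rS'
  (fun m P' => (separates_sound deltaP P' (hsep m)).2).
have bounded f P' : uniform_test alpha f -> (t x P' < +oo)%E ->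
    exists N, (f x P' <= N%:R%:E)%E.
  move=> /(ht.2)[C C0 /(_ x P') fC] tx.
  have tfin : t x P' \is a fin_num.
    by rewrite ge0_fin_numE//; exact: uniform_test_ge0 ht.1 _ _.
  exists (Num.truncn (C * fine (t x P'))).+1; apply: le_trans fC _.
  by rewrite -(fineK tfin) -EFinM lee_fin ltW// truncnS_gt.
have [NP fP] := bounded _ _ uP tP; have [NQ fQ] := bounded _ _ uQ tQ.
(* One index above both bounds suffices: a dense point [alpha a] within [2^-(k m)] of [x] has [a] in
   [S m] or not, so one of the two tests is at least [m] there. *)
pose m := (maxn NP NQ).+1.
have e0 : 0 < 2^-1 ^+ k m :> R by rewrite exprn_gt0.
have [a xa] := dense_mdist (alpha_dense hX) x e0.
have [Sa|Sa] := boolP (S m a).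
  have : (m%:R%:E <= sup_test alpha k b S x P)%E.
    apply: sup_test_ge; first by exists a.
    by have : range p (b m) by [exists (nfst (nsnd (nsnd (h m))))]; rewrite pP.
  by move=> /le_trans/(_ fP); rewrite lee_fin ler_nat /m; lia.
have : (m%:R%:E <= sup_test alpha k c S' x Q)%E.
  apply: sup_test_ge; first by exists a.
  by have : range q (c m) by [exists (nsnd (nsnd (nsnd (h m))))]; rewrite qQ.
by move=> /le_trans/(_ fQ); rewrite lee_fin ler_nat /m; lia.
Qed.

Theorem theorem25 (R : realType) (X : completeMetricType R) (alpha : nat -> X)
    (hX : constructive_metric_space alpha)
    (t : X -> Prob X -> \bar R) (ht : universal_uniform_test alpha t)
    (P Q : Prob X)
    (hP : computable_measure alpha P) (hQ : computable_measure alpha Q) :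
  orthogonal_measures P Q <-> effectively_orthogonal t P Q.
Proof.
split; first exact: (orthogonal_effectively_orthogonal hX ht hP hQ).
exact: effectively_orthogonal_orthogonal ht.1.
Qed.
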